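(* Let $n\ge 1$, $\epsilon\ge 0$ and $\beta\ge 0$ be reals, and let $A,B\subseteq\{0,1\}^n$ form a Uniquely Decodable Code Pair with $|A|\ge 2^{(1-\epsilon)n}$ and $|B|=2^{\beta n}$. Then $\beta\le 0.4228+\sqrt{\epsilon}$.
   Context: Two sets $A,B\subseteq\{0,1\}^n$ form a Uniquely Decodable Code Pair (UDCP) if every pair $(a,b)\in A\times B$ yields a distinct sum $a+b$, where addition is over $\mathbb{Z}^n$; equivalently $|A+B|=|A|\cdot|B|$ with $A+B=\{a+b: a\in A, b\in B\}$. *)

(* Defs.v *)
From mathcomp Require Import all_boot.
From Stdlib Require Import Reals.
Set Implicit Arguments. Unset Strict Implicit. Unset Printing Implicit Defensive.

Definition word (n : nat) := {ffun 'I_n -> bool}.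

Definition vsum (n : nat) (a b : word n) : {ffun 'I_n -> nat} :=
  [ffun i => (nat_of_bool (a i) + nat_of_bool (b i))%N].

Definition UDCP (n : nat) (A B : {set word n}) : Prop :=
  forall a1 a2 b1 b2, a1 \in A -> a2 \in A -> b1 \in B -> b2 \in B ->
    vsum a1 b1 = vsum a2 b2 -> a1 = a2 /\ b1 = b2.

(* Main.v *)
(** Let [d] be the Hamming distance and [Z] the sum of [t ^ d(a, b)] over
    [A * B].  Since the differences [a - b] are pairwise distinct,
    [Z <= (1 + 2 t) ^ n] (van Tilborg).  For a lower bound, pick a set [D] of
    coordinates such that [F = {b in B | b + 1_D in A}] has at least
    [|A| |B| / 2 ^ n] elements; the average over [D] is exactly that.  The words
    of [F] are determined by their restriction to [D] (compare differences) and
    also by their restriction to the complement of [D] (compare sums).  Reverse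
    hypercontractivity, applied first on the complement of [D] and then on [D],
    bounds [Z] from below.  Multiplying the bounds for [D] and for its complement
    gives [|A| ^ 126 |B| ^ 30 <= 2 ^ (138.6 n)], that is [beta <= 0.42 + 4.2 eps], which is
    enough for [sqrt eps <= 0.23]; larger [eps] follow from [|A| |B| <= 3 ^ n]
    and [|B| <= 2 ^ n]. *)

Require Import Defs.
From mathcomp Require Import all_boot all_order all_algebra ring lra.
From mathcomp Require Import Rstruct.
Set Implicit Arguments. Unset Strict Implicit. Unset Printing Implicit Defensive.
Import Order.TTheory GRing.Theory Num.Theory.
Local Open Scope ring_scope.

(** * Two-point inequalities and their duals *)

Lemma amgm_exp (R : realDomainType) (m : nat) (x y : R) : 0 <= x -> 0 <= y ->
  m.+1%:R * x ^+ m * y <= m%:R * x ^+ m.+1 + y ^+ m.+1.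
Proof.
move=> x0 y0; elim: m => [|m IH]; first by rewrite expr0 !mulr1 !mul0r !add0r mul1r.
have /= := ler_wpM2r y0 IH.
(* The induction hypothesis times [y], added to this inequality, is exactly the next case. *)
have : 0 <= m.+1%:R * x ^+ m * (x - y) ^+ 2.
  by rewrite mulr_ge0 ?sqr_ge0 // mulr_ge0 ?exprn_ge0 ?ler0n.
rewrite !exprS -![in m.+1%:R]natr1 -![in m.+2%:R]natr1 -![m.+1%:R]natr1.
set u := x ^+ m; set v := y ^+ m; set k := m%:R.
rewrite expr0 mulr1; lra.
Qed.

(** The function raised to the power [m.+1] is measured in the norm of exponent
    [m / m.+1], and the one raised to the power [j] in the norm of exponent
    [1 / j]; these powers keep every exponent integral. *)
Definition two_point (R : realDomainType) (m j : nat) (t K : R) :=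
  forall p0 p1 P g0 g1 : R, 0 <= p0 -> 0 <= p1 -> 0 <= P -> 0 <= g0 -> 0 <= g1 ->
  P ^+ m = p0 ^+ m + p1 ^+ m ->
  K * P ^+ m.+1 * (g0 + g1) ^+ j <=
  p0 ^+ m.+1 * (g0 ^+ j + t * g1 ^+ j) + p1 ^+ m.+1 * (t * g0 ^+ j + g1 ^+ j).

(** Reverse Hölder with conjugate exponents [m / m.+1] and [- m], cleared of roots: the last
    hypothesis says that [(X / h0) ^ m + (X / h1) ^ m <= 1]. AM-GM for [p] and [P * X / h], summed
    over the two terms, gives the bound. *)
Lemma reverse_holder2 (R : realFieldType) (m : nat) (p0 p1 P h0 h1 X : R) :
  (0 < m)%N -> 0 <= p0 -> 0 <= p1 -> 0 <= P -> 0 < h0 -> 0 < h1 -> 0 <= X ->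
  P ^+ m = p0 ^+ m + p1 ^+ m ->
  X ^+ m * (h0 ^+ m + h1 ^+ m) <= (h0 * h1) ^+ m ->
  X * P ^+ m.+1 <= p0 ^+ m.+1 * h0 + p1 ^+ m.+1 * h1.
Proof.
move=> m0 p00 p10 P0 h00 h10 X0 hP hX.
have m0R : 0 < m%:R :> R by rewrite ltr0n.
have key p h : 0 <= p -> 0 < h ->
    m.+1%:R * p ^+ m * P * X - P ^+ m.+1 * X * (X / h) ^+ m <= m%:R * (p ^+ m.+1 * h).
  move=> p_0 h_0.
  have q0 : 0 <= P * X / h by rewrite divr_ge0 ?mulr_ge0 // ltW.
  have /= := ler_wpM2r (ltW h_0) (amgm_exp m p_0 q0).
  have -> : m.+1%:R * p ^+ m * (P * X / h) * h = m.+1%:R * p ^+ m * P * X.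
    by field; rewrite gt_eqF.
  have -> : (m%:R * p ^+ m.+1 + (P * X / h) ^+ m.+1) * h =
     m%:R * (p ^+ m.+1 * h) + P ^+ m.+1 * X * (X / h) ^+ m.
    rewrite -mulrA exprMn !exprS; field; by rewrite gt_eqF.
  lra.
have hsum : (X / h0) ^+ m + (X / h1) ^+ m <= 1.
  have hh : 0 < (h0 * h1) ^+ m by rewrite exprn_gt0 ?mulr_gt0.
  rewrite -(ler_pM2r hh) mul1r; apply: le_trans hX; rewrite le_eqVlt; apply/orP; left.
  apply/eqP; rewrite mulrDl -!exprMn.
  have -> : X / h0 * (h0 * h1) = X * h1 by field; rewrite gt_eqF.
  have -> : X / h1 * (h0 * h1) = X * h0 by field; rewrite gt_eqF.
  by rewrite !exprMn; ring.
have k0 := key _ _ p00 h00; have k1 := key _ _ p10 h10.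
rewrite -(ler_pM2l m0R).
have PX : 0 <= P ^+ m.+1 * X by rewrite mulr_ge0 ?exprn_ge0.
have /= := ler_wpM2l PX hsum.
have e : m.+1%:R * p0 ^+ m * P * X + m.+1%:R * p1 ^+ m * P * X = (m%:R + 1) * (P ^+ m.+1 * X).
  by rewrite -natr1 exprS hP; ring.
move: k0 k1 e; rewrite mulrDr mulr1.
set a0 := (X / h0) ^+ m; set a1 := (X/h1)^+m; set PP := P ^+ m.+1.
set e0 := m.+1%:R * _ * _ * _; set e1 := m.+1%:R * _ * _ * _.
set q0 := p0 ^+ m.+1; set q1 := p1 ^+ _.
set k := m%:R.
lra.
Qed.

(** Reverse Hölder eliminates [p0] and [p1]. What remains compares the norm of exponent [- m] of
    [(h0, h1)], the noisy version of [g ^ j], with a multiple of [(g0 + g1) ^ j]. *)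
Lemma two_point_dual (R : realFieldType) (m j : nat) (t K : R) :
  (0 < m)%N -> (0 < j)%N -> 0 < t -> 0 <= K ->
  (forall g0 g1 h0 h1 : R, 0 <= g0 -> 0 <= g1 ->
     h0 = g0 ^+ j + t * g1 ^+ j -> h1 = t * g0 ^+ j + g1 ^+ j ->
     (K * (g0 + g1) ^+ j) ^+ m * (h0 ^+ m + h1 ^+ m) <= (h0 * h1) ^+ m) ->
  two_point m j t K.
Proof.
move=> m0 j0 t0 K0 dual p0 p1 P g0 g1 p00 p10 P0 g00 g10 hP.
(* Reverse Hölder needs [h0] and [h1] positive, so [g0 = g1 = 0] is treated apart. *)
case: (ltrP 0 (g0 + g1)) => [G0|G0]; last first.
  have -> : g0 = 0 by lra.
  have -> : g1 = 0 by lra.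
  by rewrite addr0 !expr0n /= eqn0Ngt j0 !mulr0 !addr0 !mulr0 addr0.
have [x0 x1] : 0 <= g0 ^+ j /\ 0 <= g1 ^+ j by rewrite !exprn_ge0.
have xx : (0 < g0 ^+ j) || (0 < g1 ^+ j).
  case: (ltrP 0 g0) => [h|h]; first by rewrite exprn_gt0.
  by rewrite orbC exprn_gt0 //; lra.
have tx0 : 0 <= t * g0 ^+ j by rewrite mulr_ge0 // ltW.
have tx1 : 0 <= t * g1 ^+ j by rewrite mulr_ge0 // ltW.
have [h0 h1] : 0 < g0 ^+ j + t * g1 ^+ j /\ 0 < t * g0 ^+ j + g1 ^+ j.
  case/orP: xx => h.
    have := mulr_gt0 t0 h; split; lra.
  have := mulr_gt0 t0 h; split; lra.
rewrite mulrAC; apply: (@reverse_holder2 _ m) => //; last exact: dual.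
by rewrite mulr_ge0 ?exprn_ge0 // ltW.
Qed.

(** With [v = x ^ 2] and [w = y ^ 2], [e] is the square of the part of
    [(x + y) ^ 6] even in [y], and [d] is [5 / 18] times the square of the odd part;
    [5 / 18] is the extremal value
    [(1 - 2 / 3) * (1 - 1 / 6)] of the squared correlation. *)
Lemma poly62_ge (R : realFieldType) (v w : R) : 0 <= v -> 0 <= w ->
  let e := (v ^+ 3 + 15 * v ^+ 2 * w + 15 * v * w ^+ 2 + w ^+ 3) ^+ 2 in
  let d := 5 / 18 * (v * w * (6 * v ^+ 2 + 20 * v * w + 6 * w ^+ 2) ^+ 2) in
  d <= e /\ v ^+ 6 * (e + d) <= (e - d) ^+ 2.
Proof.
move=> v0 w0 e d.
(* [L] keeps the two leading terms of [e - d] and lowers or drops the others. The value [5 / 18]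
   makes the coefficients of [v ^ 11 * w] in [L ^ 2] and in [v ^ 6 * (e + d)] agree, so that their
   difference has only nonnegative coefficients. *)
pose L := v ^+ 6 + 20 * v ^+ 5 * w + 15 * v ^+ 4 * w ^+ 2 + 3 * v ^+ 3 * w ^+ 3.
have L0 : 0 <= L by rewrite !addr_ge0 // !mulr_ge0 ?exprn_ge0 ?invr_ge0.
have Le : L <= e - d.
  rewrite -subr_ge0.
  have -> : e - d - L = (1560 * v ^+ 4 * w ^+ 2 + 2861 * v ^+ 3 * w ^+ 3
      + 1695 * v ^+ 2 * w ^+ 4 + 180 * v * w ^+ 5 + 9 * w ^+ 6) / 9.
    by rewrite /e /d /L; field.
  by rewrite divr_ge0 // !addr_ge0 // !mulr_ge0 ?exprn_ge0.
split; first by lra.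
apply: (@le_trans _ _ (L ^+ 2)); last by rewrite lerXn2r ?nnegrE // (le_trans L0).
rewrite -subr_ge0.
set X := (X in 0 <= X).
have -> : X = (975 * v ^+ 10 * w ^+ 2 + 206 * v ^+ 9 * w ^+ 3 + 210 * v ^+ 8 * w ^+ 4
    + 450 * v ^+ 7 * w ^+ 5 + 72 * v ^+ 6 * w ^+ 6) / 9.
  by rewrite /X /L /e /d; field.
by rewrite divr_ge0 // !addr_ge0 // !mulr_ge0 ?exprn_ge0.
Qed.

(** As above for [(x + y) ^ 4], with [3 / 20 = (1 - 4 / 5) * (1 - 1 / 4)]. *)
Lemma poly44_ge (R : realFieldType) (v w : R) : 0 <= v -> 0 <= w ->
  let e := (v ^+ 2 + 6 * v * w + w ^+ 2) ^+ 2 in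
  let d := 3 / 20 * (16 * v * w * (v + w) ^+ 2) in
  d <= e /\ v ^+ 8 * (e ^+ 2 + 6 * e * d + d ^+ 2) <= (e - d) ^+ 4.
Proof.
move=> v0 w0 e d.
(* Here [L] keeps the two leading terms of [(e - d) ^ 2], and [3 / 20] makes the coefficients of
   [v ^ 15 * w] agree. *)
pose L := v ^+ 8 + 96 / 5 * v ^+ 7 * w + 50 * v ^+ 6 * w ^+ 2 + 40 * v ^+ 5 * w ^+ 3
   + 40 * v ^+ 4 * w ^+ 4.
have L0 : 0 <= L by rewrite !addr_ge0 // !mulr_ge0 ?exprn_ge0 ?invr_ge0.
have ed : d <= e.
  rewrite -subr_ge0.
  have -> : e - d = (5 * v ^+ 4 + 48 * v ^+ 3 * w + 166 * v ^+ 2 * w ^+ 2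
      + 48 * v * w ^+ 3 + 5 * w ^+ 4) / 5 by rewrite /e /d; field.
  by rewrite divr_ge0 // !addr_ge0 // !mulr_ge0 ?exprn_ge0.
have Le : L <= (e - d) ^+ 2.
  rewrite -subr_ge0.
  have -> : (e - d) ^+ 2 - L = (2714 * v ^+ 6 * w ^+ 2
      + 25 * 616 * v ^+ 5 * w ^+ 3 + 16 * v ^+ 5 * w ^+ 3
      + 25 * 1248 * v ^+ 4 * w ^+ 4 + 14 * v ^+ 4 * w ^+ 4
      + 25 * 656 * v ^+ 3 * w ^+ 5 + 16 * v ^+ 3 * w ^+ 5
      + 25 * 158 * v ^+ 2 * w ^+ 6 + 14 * v ^+ 2 * w ^+ 6 + 480 * v * w ^+ 7 + 25 * w ^+ 8) / 25.
    by rewrite /e /d /L; field.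
  by rewrite divr_ge0 // !addr_ge0 // !mulr_ge0 ?exprn_ge0.
split => //.
rewrite [_ ^+ 4](exprM _ 2 2).
apply: (@le_trans _ _ (L ^+ 2)); last by rewrite lerXn2r ?nnegrE // (le_trans L0).
rewrite -subr_ge0.
set X := (X in 0 <= X).
have -> : X = (1032 * v ^+ 14 * w ^+ 2 + 3344 * v ^+ 13 * w ^+ 3
    + 25 * 907 * v ^+ 12 * w ^+ 4 + 11 * v ^+ 12 * w ^+ 4
    + 25 * 3669 * v ^+ 11 * w ^+ 5 + 19 * v ^+ 11 * w ^+ 5
    + 25 * 2 * 2586 * v ^+ 10 * w ^+ 6 + 16 * v ^+ 10 * w ^+ 6
    + 25 * 3161 * v ^+ 9 * w ^+ 7 + 15 * v ^+ 9 * w ^+ 7 + 25 * 1599 * v ^+ 8 * w ^+ 8) / 25.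
  by rewrite /X /L /e /d; field.
by rewrite divr_ge0 // !addr_ge0 // !mulr_ge0 ?exprn_ge0.
Qed.

(** * Subcubes, and tensorization of the two-point inequality *)

Definition subcube (n : nat) (S : {set 'I_n}) (w : word n) : {set word n} :=
  [set y : word n | [forall i : 'I_n, (i \notin S) ==> (y i == w i)]].

Definition hdist (n : nat) (S : {set 'I_n}) (x y : word n) : nat :=
  \sum_(i in S) (x i != y i).

(** Such a [B] behaves like a subset of the cube on [S], yet its elements remain full words, so
    weights on [B] may depend on coordinates outside [S]. *)
Definition inj_on_coords (n : nat) (S : {set 'I_n}) (B : {set word n}) :=
  forall x y, x \in B -> y \in B -> {in S, x =1 y} -> x = y.

Definition update (n : nat) (w : word n) (i : 'I_n) (z : bool) : word n :=
  [ffun k => if k == i then z else w k].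

Lemma subcubeP (n : nat) (S : {set 'I_n}) (w y : word n) :
  reflect {in ~: S, y =1 w} (y \in subcube S w).
Proof.
rewrite inE; apply: (iffP forallP) => [h i|h i].
  by rewrite inE => hi; apply/eqP; have := h i; rewrite hi.
by apply/implyP => hi; apply/eqP/h; rewrite inE.
Qed.

Lemma subcube0 (n : nat) (w : word n) : subcube set0 w = [set w].
Proof.
apply/setP => y; rewrite in_set1; apply/subcubeP/eqP => [h|-> //].
by apply/ffunP => i; apply: h; rewrite !inE.
Qed.

Lemma subcube_slice (n : nat) (S : {set 'I_n}) (w y : word n) (i : 'I_n) (z : bool) :
  i \in S ->
  (y \in subcube S w) && (y i == z) = (y \in subcube (S :\ i) (update w i z)).
Proof.
move=> iS; apply/andP/subcubeP => [[/subcubeP h /eqP hz] k|h].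
  rewrite !inE ffunE; case: eqP => [-> //|_] /= kS.
  by apply: h; rewrite inE.
split; last by have := h i; rewrite !inE eqxx ffunE eqxx => ->.
apply/subcubeP => k; rewrite inE => kS.
have ki : (k == i) = false by apply/eqP => e; rewrite e iS in kS.
by have := h k; rewrite !inE ki kS ffunE ki => ->.
Qed.

Lemma sum_subcubeD1 (V : nmodType) (n : nat) (S : {set 'I_n}) (w : word n)
    (i : 'I_n) (F : word n -> V) : i \in S ->
  \sum_(y in subcube S w) F y =
  \sum_(y in subcube (S :\ i) (update w i false)) F y +
  \sum_(y in subcube (S :\ i) (update w i true)) F y.
Proof.
move=> iS; rewrite (partition_big (fun y : word n => y i) xpredT) //= big_bool /= addrC.
by congr (_ + _); apply: eq_bigl => y; rewrite subcube_slice.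
Qed.

Lemma sum_coordD1 (V : nmodType) (n : nat) (B : {set word n}) (i : 'I_n) (F : word n -> V) :
  \sum_(x in B) F x =
  \sum_(x in [set x in B | x i == false]) F x + \sum_(x in [set x in B | x i == true]) F x.
Proof.
rewrite (partition_big (fun y : word n => y i) xpredT) //= big_bool /= addrC.
by congr (_ + _); apply: eq_bigl => y; rewrite inE.
Qed.

Lemma hdistD1 (n : nat) (S : {set 'I_n}) (i : 'I_n) (x y : word n) : i \in S ->
  hdist S x y = ((x i != y i) + hdist (S :\ i) x y)%N.
Proof. by move=> iS; rewrite /hdist (big_setD1 i). Qed.

(** [P] is the [m]-th root of the sum over [B]; [root] only serves to take the
    corresponding roots for the two halves of [B] in the induction on [S]. *)
Lemma reverse_hypercontractivity (R : realFieldType) (n m j : nat) (t K : R)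
    (root : R -> R) (c g : word n -> R) :
  (0 < m)%N -> 0 <= t -> 0 <= K ->
  (forall x, 0 <= x -> 0 <= root x /\ root x ^+ m = x) ->
  two_point m j t K ->
  (forall x, 0 <= c x) -> (forall y, 0 <= g y) ->
  forall (S : {set 'I_n}) (B : {set word n}) (w : word n) (P : R),
  inj_on_coords S B -> 0 <= P -> P ^+ m = \sum_(x in B) c x ^+ m ->
  K ^+ #|S| * P ^+ m.+1 * (\sum_(y in subcube S w) g y) ^+ j <=
  \sum_(x in B) \sum_(y in subcube S w) c x ^+ m.+1 * g y ^+ j * t ^+ hdist S x y.
Proof.
move=> m0 t0 K0 rootP tp c0 g0 S.
move cS : #|S| => k; elim: k S cS => [|k IH] S cS B w P injB P0 hP.
  (* With [S] empty, [injB] leaves at most one word in [B]. *)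
  move/eqP: cS; rewrite cards_eq0 => /eqP S0; subst S.
  have [B0|[b bB]] := set_0Vmem B.
    move: hP; rewrite B0 !big_set0 => /eqP; rewrite expf_eq0 m0 /= => /eqP ->.
    by rewrite [0 ^+ m.+1]expr0n /= mulr0 mul0r.
  have Bb : B = [set b].
    apply/setP => x; rewrite inE; apply/idP/eqP => [xB|-> //].
    by apply: injB => // i; rewrite inE.
  have hP' : P = c b.
    by move: hP; rewrite Bb big_set1 => /eqP; rewrite eqrXn2 // => /eqP.
  rewrite Bb subcube0 !big_set1 /hdist big_set0 !expr0 mul1r mulr1 hP' //.
have [i iS] : exists i, i \in S by apply/set0Pn; rewrite -card_gt0 cS.
have cS' : #|S :\ i| = k by move: cS; rewrite (cardsD1 i S) iS /= => -[].
(* Both [B] and the subcube are split at coordinate [i]. The induction hypothesis bounds the four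
   sums [T z z'], where [z != z'] costs a factor [t], and the two-point inequality recombines
   them. *)
pose Bz z := [set x in B | x i == z].
pose G z := \sum_(y in subcube (S :\ i) (update w i z)) g y.
pose P_ z := root (\sum_(x in Bz z) c x ^+ m).
pose T z z' := \sum_(x in Bz z) \sum_(y in subcube (S :\ i) (update w i z'))
   c x ^+ m.+1 * g y ^+ j * t ^+ hdist (S :\ i) x y.
have Pz z : 0 <= P_ z /\ P_ z ^+ m = \sum_(x in Bz z) c x ^+ m.
  by apply: rootP; apply: sumr_ge0 => x _; rewrite exprn_ge0.
have injz z : inj_on_coords (S :\ i) (Bz z).
  move=> x y; rewrite !inE => /andP[xB /eqP xi] /andP[yB /eqP yi] h.
  apply: injB => // l lS; have [->|li] := eqVneq l i; first by rewrite xi yi.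
  by apply: h; rewrite !inE li.
have IHz z z' : K ^+ k * P_ z ^+ m.+1 * G z' ^+ j <= T z z'.
  by apply: IH => //; case: (Pz z).
have Gz z : 0 <= G z by apply: sumr_ge0.
have -> : \sum_(x in B) \sum_(y in subcube S w) c x ^+ m.+1 * g y ^+ j * t ^+ hdist S x y
   = (T false false + t * T false true) + (t * T true false + T true true).
  rewrite (sum_coordD1 _ i); congr (_ + _);
  rewrite mulr_sumr -big_split; apply: eq_bigr => x; rewrite inE => /andP[xB /eqP xi] /=;
  rewrite (sum_subcubeD1 _ _ iS); congr (_ + _); rewrite ?mulr_sumr;
  apply: eq_bigr => y; rewrite -subcube_slice // => /andP[_ /eqP yi];
  rewrite (hdistD1 _ _ iS) xi yi /= ?add0n // exprD expr1; ring.
have -> : \sum_(y in subcube S w) g y = G false + G true by rewrite (sum_subcubeD1 _ _ iS).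
have := tp (P_ false) (P_ true) P (G false) (G true).
case: (Pz false) => pf hf; case: (Pz true) => pt ht.
rewrite hf ht hP (sum_coordD1 _ i) => /(_ pf pt P0 (Gz _) (Gz _) erefl) htp.
have Kk : 0 <= K ^+ k by rewrite exprn_ge0.
have := ler_wpM2l Kk htp; rewrite /= => {}htp.
have i00 := IHz false false; have i11 := IHz true true.
have i01 := ler_wpM2l t0 (IHz false true); have i10 := ler_wpM2l t0 (IHz true false).
rewrite exprS.
apply: le_trans (_ : _ <= K ^+ k * P_ false ^+ m.+1 * G false ^+ j +
   t * (K ^+ k * P_ false ^+ m.+1 * G true ^+ j) +
   (t * (K ^+ k * P_ true ^+ m.+1 * G false ^+ j) +
   K ^+ k * P_ true ^+ m.+1 * G true ^+ j)) _; last by rewrite !lerD.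
move: htp; set a := P ^+ m.+1; set b := (G false + G true) ^+ j.
move=> htp; apply: (le_trans (le_trans _ htp)).
  by rewrite le_eqVlt; apply/orP; left; apply/eqP; ring.
by rewrite le_eqVlt; apply/orP; left; apply/eqP; ring.
Qed.

(** * The two-point inequality for the two exponent pairs in use *)

Lemma two_point_26 (R : realFieldType) (t K : R) : 0 < t -> 0 <= K ->
  K ^+ 2 * 2 ^+ 13 = (1 + t) ^+ 2 -> 18 * (1 - t) ^+ 2 <= 5 * (1 + t) ^+ 2 ->
  two_point 2 6 t K.
Proof.
move=> t0 K0 hK ht; apply: two_point_dual => // g0 g1 h0 h1 g00 g10 h0E h1E.
(* If [E] and [O] are the parts of [(x + y) ^ 6] even and odd in [y], then
   [h0 = (1 + t) E + (1 - t) O] and [h1 = (1 + t) E - (1 - t) O]. Hence [h0 * h1] and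
   [h0 ^ 2 + h1 ^ 2] involve only [v] and [w]. *)
pose x := (g0 + g1) / 2; pose y := (g0 - g1) / 2.
have e0 : g0 = x + y by rewrite /x /y; field.
have e1 : g1 = x - y by rewrite /x /y; field.
pose v := x ^+ 2; pose w := y ^+ 2.
have v0 : 0 <= v by rewrite sqr_ge0.
have w0 : 0 <= w by rewrite sqr_ge0.
have [] := poly62_ge v0 w0.
set e := (_ + _ + _ + _) ^+ 2; set o := v * w * _; set d := _ * o => de hp.
have o0 : 0 <= o by rewrite mulr_ge0 ?sqr_ge0 // mulr_ge0.
pose q := (1 + t) ^+ 2; pose r := (1 - t) ^+ 2.
have q0 : 0 <= q by rewrite sqr_ge0.
(* [ht] bounds the squared correlation [r / q] by [5 / 18]. *)
have rq : r * o <= q * d.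
  rewrite /d mulrA; apply: ler_wpM2r => //; rewrite /r /q; lra.
have hh : h0 * h1 = q * e - r * o.
  by rewrite h0E h1E /q /r /e /o /v /w e0 e1; ring.
have hs : h0 ^+ 2 + h1 ^+ 2 = 2 * (q * e + r * o).
  by rewrite h0E h1E /q /r /e /o /v /w e0 e1; ring.
have -> : g0 + g1 = 2 * x by rewrite e0 e1; ring.
have -> : (K * (2 * x) ^+ 6) ^+ 2 * (h0 ^+ 2 + h1 ^+ 2) = q * v ^+ 6 * (q * e + r * o).
  rewrite hs; move: (q * e + r * o) => z.
  by rewrite (_ : q = K ^+ 2 * 2 ^+ 13) // /v; ring.
have qv : 0 <= q * v ^+ 6 by rewrite mulr_ge0 // exprn_ge0.
apply: (@le_trans _ _ (q * v ^+ 6 * (q * (e + d)))).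
  by rewrite ler_wpM2l // mulrDr lerD2l.
apply: (@le_trans _ _ (q ^+ 2 * (e - d) ^+ 2)).
  have -> : q * v ^+ 6 * (q * (e + d)) = q ^+ 2 * (v ^+ 6 * (e + d)).
    by ring.
  by rewrite ler_wpM2l ?sqr_ge0.
have ed : 0 <= q * (e - d) by rewrite mulr_ge0 // subr_ge0.
have le : q * (e - d) <= q * e - r * o by rewrite mulrBr lerD2l lerN2.
by rewrite -exprMn hh lerXn2r ?nnegrE // (le_trans ed).
Qed.

(** As in [two_point_26], the constant [K] is the one for which [g0 = g1] is an equality case of the
    dual inequality. *)
Lemma two_point_44 (R : realFieldType) (t K : R) : 0 < t -> 0 <= K ->
  K ^+ 4 * 2 ^+ 17 = (1 + t) ^+ 4 -> 20 * (1 - t) ^+ 2 <= 3 * (1 + t) ^+ 2 ->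
  two_point 4 4 t K.
Proof.
move=> t0 K0 hK ht; apply: two_point_dual => // g0 g1 h0 h1 g00 g10 h0E h1E.
pose x := (g0 + g1) / 2; pose y := (g0 - g1) / 2.
have e0 : g0 = x + y by rewrite /x /y; field.
have e1 : g1 = x - y by rewrite /x /y; field.
pose v := x ^+ 2; pose w := y ^+ 2.
have v0 : 0 <= v by rewrite sqr_ge0.
have w0 : 0 <= w by rewrite sqr_ge0.
have [] := poly44_ge v0 w0.
set e := (_ + _ + _) ^+ 2; set o := 16 * v * w * _; set d := _ * o => de hp.
have e_0 : 0 <= e by rewrite sqr_ge0.
have o0 : 0 <= o by rewrite mulr_ge0 ?sqr_ge0 // mulr_ge0 // mulr_ge0.
pose q := (1 + t) ^+ 2; pose r := (1 - t) ^+ 2.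
have q0 : 0 <= q by rewrite sqr_ge0.
have r0 : 0 <= r by rewrite sqr_ge0.
have ro0 : 0 <= r * o by rewrite mulr_ge0.
have rq : r * o <= q * d.
  rewrite /d mulrA; apply: ler_wpM2r => //; rewrite /r /q; lra.
have qe : 0 <= q * e by rewrite mulr_ge0.
have hh : h0 * h1 = q * e - r * o.
  by rewrite h0E h1E /q /r /e /o /v /w e0 e1; ring.
have hs : h0 ^+ 2 + h1 ^+ 2 = 2 * (q * e + r * o).
  by rewrite h0E h1E /q /r /e /o /v /w e0 e1; ring.
have hs4 : h0 ^+ 4 + h1 ^+ 4 = 2 * ((q * e) ^+ 2 + 6 * (q * e) * (r * o) + (r * o) ^+ 2).
  have -> : h0 ^+ 4 + h1 ^+ 4 = (h0 ^+ 2 + h1 ^+ 2) ^+ 2 - 2 * (h0 * h1) ^+ 2.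
    by ring.
  by rewrite hs hh; move: (q * e) (r * o) => a b; ring.
have -> : g0 + g1 = 2 * x by rewrite e0 e1; ring.
have q2 : q ^+ 2 = K ^+ 4 * 2 ^+ 17 by rewrite hK /q; ring.
have -> : (K * (2 * x) ^+ 4) ^+ 4 * (h0 ^+ 4 + h1 ^+ 4) =
    q ^+ 2 * v ^+ 8 * ((q * e) ^+ 2 + 6 * (q * e) * (r * o) + (r * o) ^+ 2).
  by rewrite hs4 q2 /v; move: (_ + _ + _) => z; ring.
have qv : 0 <= q ^+ 2 * v ^+ 8 by rewrite mulr_ge0 // exprn_ge0.
apply: (@le_trans _ _ (q ^+ 2 * v ^+ 8 * ((q * e) ^+ 2 + 6 * (q * e) * (q * d) + (q * d) ^+ 2))).
  rewrite ler_wpM2l // lerD //; last by rewrite lerXn2r ?nnegrE // (le_trans ro0).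
  by rewrite lerD2l ler_wpM2l // mulr_ge0.
apply: (@le_trans _ _ (q ^+ 4 * (e - d) ^+ 4)).
  have -> : q ^+ 2 * v ^+ 8 * ((q * e) ^+ 2 + 6 * (q * e) * (q * d) + (q * d) ^+ 2) =
     q ^+ 4 * (v ^+ 8 * (e ^+ 2 + 6 * e * d + d ^+ 2)).
    by ring.
  by rewrite ler_wpM2l // exprn_ge0.
have ed : 0 <= q * (e - d) by rewrite mulr_ge0 // subr_ge0.
have le : q * (e - d) <= q * e - r * o by rewrite mulrBr lerD2l lerN2.
by rewrite -exprMn hh lerXn2r ?nnegrE // (le_trans ed).
Qed.

(** * Differences, van Tilborg's inequality and flippable words *)

Definition diff_pattern (n : nat) (p : word n * word n) : {ffun 'I_n -> option bool} :=
  [ffun i => if p.1 i == p.2 i then None else Some (p.2 i)].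

(** A pattern encodes [a - b]: [None] stands for 0 and [Some] carries the sign. Now
    [a - b = a' - b'] means [a + b' = a' + b], which unique decoding resolves. *)
Lemma diff_pattern_inj (n : nat) (A B : {set word n}) : UDCP A B ->
  {in setX A B &, injective (@diff_pattern n)}.
Proof.
move=> AB [a b] [a' b']; rewrite !inE /= => /andP[aA bB] /andP[aA' bB'] /ffunP h.
suff : vsum a b' = vsum a' b by move=> /AB [] // -> ->.
apply/ffunP => i; have := h i; rewrite !ffunE /=.
by case: (a i) (b i) (a' i) (b' i) => [] [] [] [].
Qed.

(** With weight 1 on [None] and [t] on [Some], the pattern of [(a, b)] weighs [t ^ d(a, b)] and all
    patterns together weigh [(1 + 2 t) ^ n]. Distinct pairs have distinct patterns, so the left side
    is a partial sum. *)
Lemma van_Tilborg (R : realFieldType) (n : nat) (A B : {set word n}) (t : R) :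
  UDCP A B -> 0 <= t ->
  \sum_(a in A) \sum_(b in B) t ^+ hdist setT b a <= (1 + 2 * t) ^+ n.
Proof.
move=> AB t0.
pose wt (o : option bool) : R := if o is None then 1 else t.
have wt0 o : 0 <= wt o by case: o => //= _; rewrite ler01.
have -> : (1 + 2 * t) ^+ n = \sum_(s : {ffun 'I_n -> option bool}) \prod_i wt (s i).
  rewrite -(bigA_distr_bigA (fun _ : 'I_n => wt)) /= prodr_const card_ord; congr (_ ^+ _).
  rewrite (bigD1 None) //= (bigD1 (Some true)) //= (bigD1 (Some false)) //= big1.
    by rewrite addr0; ring.
  by case=> [[]|].
rewrite pair_big /=.
have -> : \sum_(p | (p.1 \in A) && (p.2 \in B)) t ^+ hdist setT p.2 p.1 =
   \sum_(p in setX A B) \prod_i wt (diff_pattern p i).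
  apply: eq_big => [[a b]|[a b] _] /=; first by rewrite inE.
  rewrite /hdist -prodrXr; apply: eq_big => [i|i _]; first by rewrite inE.
  by rewrite ffunE /= eq_sym; case: eqP.
rewrite -(big_imset (fun s : {ffun _} => \prod_i wt (s i)) (diff_pattern_inj AB)) /=.
rewrite [leRHS](bigID (mem [set diff_pattern x | x in setX A B])) /=.
by rewrite lerDl; apply: sumr_ge0 => s _; apply: prodr_ge0.
Qed.

Definition flip (n : nat) (D : {set 'I_n}) (b : word n) : word n :=
  [ffun i => b i (+) (i \in D)].

Definition flippable (n : nat) (A B : {set word n}) (D : {set 'I_n}) : {set word n} :=
  [set b in B | flip D b \in A].

(** If [x] and [y] agree on [D], then [flip D x + y = flip D y + x]: both are 1 on [D] and [x + y]
    off [D]. *)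
Lemma flippable_inj (n : nat) (A B : {set word n}) (D : {set 'I_n}) : UDCP A B ->
  inj_on_coords D (flippable A B D).
Proof.
move=> AB x y; rewrite !inE => /andP[xB xA] /andP[yB yA] h.
suff : vsum (flip D x) y = vsum (flip D y) x by move=> /AB [].
apply/ffunP => i; rewrite !ffunE; case: (boolP (i \in D)) => iD.
  by rewrite h.
by rewrite !addbF addnC.
Qed.

(** The sum [flip D x + x] is 1 on [D] and [2 x] off [D], so it only sees [x] off [D]. *)
Lemma flippable_injC (n : nat) (A B : {set word n}) (D : {set 'I_n}) : UDCP A B ->
  inj_on_coords (~: D) (flippable A B D).
Proof.
move=> AB x y; rewrite !inE => /andP[xB xA] /andP[yB yA] h.
suff : vsum (flip D x) x = vsum (flip D y) y by move=> /AB [].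
apply/ffunP => i; rewrite !ffunE; case: (boolP (i \in D)) => iD.
  by rewrite !addbT; case: (x i) (y i) => [] [].
by rewrite h ?inE.
Qed.

(** A pair [(a, b)] is counted for exactly one [D], the set where [a] and [b] differ. *)
Lemma sum_flippable (n : nat) (A B : {set word n}) :
  (\sum_(D : {set 'I_n}) #|flippable A B D| = #|A| * #|B|)%N.
Proof.
rewrite -cardsX -sum1_card.
rewrite (partition_big (fun p : word n * word n => [set i | p.1 i != p.2 i]) xpredT) //=.
apply: eq_bigr => D _; rewrite sum1_card.
have inj : injective (fun b : word n => (flip D b, b)) by move=> x y [].
rewrite -(card_imset _ inj); apply: eq_card => -[a b].
rewrite [RHS]unfold_in /= inE /=; apply/imsetP/andP.
  move=> [x]; rewrite inE => /andP[xB xA] [-> ->]; split; first by rewrite xA.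
  by apply/eqP/setP => i; rewrite inE ffunE; case: (x i) (i \in D) => [] [].
move=> [/andP[aA bB] /eqP e].
have fb : a = flip D b.
  apply/ffunP => i; rewrite ffunE -e inE.
  by case: (a i) (b i) => [] [].
by exists b; rewrite ?inE ?bB -?fb.
Qed.

Lemma exists_flippable (n : nat) (A B : {set word n}) :
  exists D : {set 'I_n}, (#|A| * #|B| <= #|flippable A B D| * 2 ^ n)%N.
Proof.
case: (pickP (fun D : {set 'I_n} => #|A| * #|B| <= #|flippable A B D| * 2 ^ n)%N) => [D h|h].
  by exists D.
have cT : #|{set 'I_n}| = (2 ^ n)%N.
  by rewrite -cardsT -powersetT card_powerset cardsT card_ord.
have : (\sum_(D : {set 'I_n}) (#|flippable A B D| * 2 ^ n + 1) <=
        \sum_(D : {set 'I_n}) #|A| * #|B|)%N.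
  by apply: leq_sum => D _; rewrite addn1 ltnNge h.
rewrite big_split -big_distrl sum_flippable !sum_nat_const cT muln1.
by rewrite [leqRHS]mulnC -[leqRHS]addn0 leq_add2l leqn0 expn_eq0.
Qed.

(** * The two-stage lower bound and the resulting density bound *)

Lemma power_mean23 (R : rcfType) (T : finType) (U : {set T}) (W : T -> R) :
  (forall u, 0 <= W u) ->
  (\sum_(u in U) W u ^+ 2) ^+ 3 <= #|U|%:R * (\sum_(u in U) W u ^+ 3) ^+ 2.
Proof.
move=> W0; have [->|/set0Pn[u0 u0U]] := eqVneq U set0.
  by rewrite !big_set0 cards0 mul0r expr0n.
have N0 : 0 < #|U|%:R :> R by rewrite ltr0n; apply/card_gt0P; exists u0.
set N := #|U|%:R in N0 *; set S2 := \sum_(u in U) _; set S3 := \sum_(u in U) W u ^+ 3.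
have S20 : 0 <= S2 by apply: sumr_ge0 => u _; rewrite exprn_ge0.
have S30 : 0 <= S3 by apply: sumr_ge0 => u _; rewrite exprn_ge0.
(* [l] is the quadratic mean of [W]; summing AM-GM against it yields [N * l ^ 3 <= S3]. *)
pose l := Num.sqrt (S2 / N).
have l0 : 0 <= l by apply: sqrtr_ge0.
have hl : S2 = N * l ^+ 2.
  by rewrite /l sqr_sqrtr ?divr_ge0 // ?ltW //; field; rewrite gt_eqF.
have : \sum_(u in U) 3%:R * W u ^+ 2 * l <= \sum_(u in U) (2%:R * W u ^+ 3 + l ^+ 3).
  by apply: ler_sum => u _; apply: amgm_exp.
rewrite -mulr_suml -mulr_sumr big_split /= -mulr_sumr -/S2 -/S3 sumr_const
  -[_ *+ #|U|]mulr_natl -/N => h.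
have {}h : N * l ^+ 3 <= S3.
  move: h; rewrite hl.
  have -> : 3 * (N * l ^+ 2) * l = 3 * (N * l ^+ 3) by ring.
  by move: (N * l ^+ 3) => z; lra.
have Nl : 0 <= N * l ^+ 3 by rewrite mulr_ge0 ?exprn_ge0 // ltW.
have -> : S2 ^+ 3 = N * (N * l ^+ 3) ^+ 2 by rewrite hl; ring.
by rewrite ler_pM2l // lerXn2r ?nnegrE.
Qed.

Lemma card_subcube (n : nat) (S : {set 'I_n}) (w : word n) : #|subcube S w| = (2 ^ #|S|)%N.
Proof.
move cS : #|S| => k; elim: k S w cS => [|k IH] S w cS.
  by move/eqP: cS; rewrite cards_eq0 => /eqP ->; rewrite subcube0 cards1.
have [i iS] : exists i, i \in S by apply/set0Pn; rewrite -card_gt0 cS.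
have cS' : #|S :\ i| = k by move: cS; rewrite (cardsD1 i S) iS /= => -[].
rewrite -sum1_card (sum_subcubeD1 w (fun=> 1%N) iS) !sum1_card !IH //.
by rewrite expnS mul2n -addnn.
Qed.

Lemma sum_subcube_fibers (V : nmodType) (n : nat) (D : {set 'I_n}) (w : word n)
    (F : word n -> V) :
  \sum_(u in subcube D w) \sum_(v in subcube (~: D) u) F v = \sum_v F v.
Proof.
pose p (v : word n) : word n := [ffun i => if i \in D then v i else w i].
rewrite [RHS](partition_big p (mem (subcube D w))) /=; last first.
  move=> v _; apply/subcubeP => i; rewrite inE ffunE => /negbTE -> //.
apply: eq_bigr => u /subcubeP uD; apply: eq_bigl => v.
apply/subcubeP/eqP => [h|<- i].
  apply/ffunP => i; rewrite ffunE; case: ifP => iD; first by rewrite h ?setCK.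
  by rewrite uD // inE iD.
by rewrite setCK ffunE => ->.
Qed.

Lemma hdistT (n : nat) (D : {set 'I_n}) (u v b : word n) : v \in subcube (~: D) u ->
  hdist setT b v = (hdist D b u + hdist (~: D) b v)%N.
Proof.
move=> /subcubeP h; rewrite /hdist (bigID (mem D)) /=; congr (_ + _)%N.
  apply: eq_big => [i|i /andP[_ iD]]; first by rewrite !inE.
  by rewrite h // setCK.
by apply: eq_bigl => i; rewrite !inE.
Qed.

(** The first stage has exponents [2 / 3] and [1 / 6], the second [4 / 5] and [1 / 4]. The norm of
    exponent [2 / 3] turns the remaining noise [s ^ 3] on [D] into [s ^ 2], hence the two conditions
    on [s]. The eighth power clears all roots. *)
Lemma two_stage (R : rcfType) (n : nat) (A B : {set word n}) (D : {set 'I_n}) (s : R) :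
  inj_on_coords D B -> inj_on_coords (~: D) B -> 0 < s ->
  18 * (1 - s ^+ 3) ^+ 2 <= 5 * (1 + s ^+ 3) ^+ 2 ->
  20 * (1 - s ^+ 2) ^+ 2 <= 3 * (1 + s ^+ 2) ^+ 2 ->
  ((1 + s ^+ 3) ^+ 8 / 2 ^+ 52) ^+ #|~: D| * ((1 + s ^+ 2) ^+ 12 / 2 ^+ 55) ^+ #|D| *
    #|B|%:R ^+ 15 * #|A|%:R ^+ 48 <=
  (\sum_(a in A) \sum_(b in B) (s ^+ 3) ^+ hdist setT b a) ^+ 8.
Proof.
move=> injD injC s0 hs3 hs2.
set Z := \sum_(a in A) _.
have s_ge0 : 0 <= s by rewrite ltW.
pose K2 := Num.sqrt ((1 + s ^+ 3) ^+ 2 / 2 ^+ 13).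
pose root4 (x : R) := Num.sqrt (Num.sqrt x).
pose K1 := root4 ((1 + s ^+ 2) ^+ 4 / 2 ^+ 17).
have root4P x : 0 <= x -> 0 <= root4 x /\ root4 x ^+ 4 = x.
  by move=> x0; split; rewrite ?sqrtr_ge0 // (exprM _ 2 2) !sqr_sqrtr ?sqrtr_ge0.
have root2P x : 0 <= x :> R -> 0 <= Num.sqrt x /\ Num.sqrt x ^+ 2 = x.
  by move=> x0; split; rewrite ?sqrtr_ge0 // sqr_sqrtr.
have t3 : 0 < s ^+ 3 by rewrite exprn_gt0.
have t2 : 0 < s ^+ 2 by rewrite exprn_gt0.
have p2 k : 0 < 2 ^+ k :> R by rewrite exprn_gt0.
have [K20 K2E] : 0 <= K2 /\ K2 ^+ 2 = (1 + s ^+ 3) ^+ 2 / 2 ^+ 13.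
  by apply: root2P; rewrite divr_ge0 ?sqr_ge0 // ltW.
have [K10 K1E] : 0 <= K1 /\ K1 ^+ 4 = (1 + s ^+ 2) ^+ 4 / 2 ^+ 17.
  by apply: root4P; rewrite divr_ge0 ?exprn_ge0 ?addr_ge0 // ltW.
have tp2 : two_point 2 6 (s ^+ 3) K2.
  by apply: two_point_26 => //; rewrite K2E divfK // gt_eqF.
have tp1 : two_point 4 4 (s ^+ 2) K1.
  by apply: two_point_44 => //; rewrite K1E divfK // gt_eqF.
pose w0 : word n := [ffun=> false].
pose g (a : word n) : R := (a \in A)%:R.
have g0 a : 0 <= g a by rewrite ler0n.
pose Au u := \sum_(v in subcube (~: D) u) g v.
have Au0 u : 0 <= Au u by apply: sumr_ge0.
pose Fu u := \sum_(b in B) (s ^+ 2) ^+ hdist D b u.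
have Fu0 u : 0 <= Fu u by apply: sumr_ge0 => b _; rewrite exprn_ge0 // ltW.
(* The first stage bounds the slice at [u] below by [K2 ^ #|~: D| * W u ^ 3]; the second bounds the
   sum of [W u ^ 2 = Fu u * Au u ^ 4]. The power mean inequality links them. *)
pose W u := Num.sqrt (Fu u) * Au u ^+ 2.
have W0 u : 0 <= W u by rewrite mulr_ge0 ?sqrtr_ge0 ?sqr_ge0.
pose S2 := \sum_(u in subcube D w0) W u ^+ 2.
pose S3 := \sum_(u in subcube D w0) W u ^+ 3.
have S30 : 0 <= S3 by apply: sumr_ge0 => u _; rewrite exprn_ge0.
have hZ : K2 ^+ #|~: D| * S3 <= Z.
  have -> : Z = \sum_(u in subcube D w0) \sum_(v in subcube (~: D) u) \sum_(b in B)
      g v * (s ^+ 3) ^+ hdist setT b v.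
    rewrite sum_subcube_fibers /Z big_mkcond; apply: eq_bigr => v _.
    by rewrite /g -mulr_sumr; case: (v \in A); rewrite ?mul1r ?mul0r.
  rewrite mulr_sumr; apply: ler_sum => u uD; rewrite exchange_big /=.
  (* The weight [s ^ hdist D b u] carries the distance on [D]: its cube completes
     [(s ^ 3) ^ hdist setT b v], and its squares sum to [Fu u]. *)
  have := reverse_hypercontractivity (g := g) (c := fun b => s ^+ hdist D b u)
    (isT : (0 < 2)%N) (ltW t3) K20 root2P tp2 _ g0 u injC (sqrtr_ge0 (Fu u)).
  have -> : K2 ^+ #|~: D| * W u ^+ 3 =
      K2 ^+ #|~: D| * Num.sqrt (Fu u) ^+ 3 * Au u ^+ 6.
    by rewrite /W; ring.
  move=> /(_ _ _)/le_trans; apply.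
  - by move=> b; rewrite exprn_ge0.
  - by rewrite sqr_sqrtr //; apply: eq_bigr => b _; rewrite -!exprM mulnC.
  apply: ler_sum => b _; apply: ler_sum => v vu.
  rewrite (hdistT _ vu) exprD -!exprM [(hdist D b u * 3)%N]mulnC /g.
  by case: (v \in A); rewrite ?expr1n ?mul1r ?mulr1 // expr0n /= mulr0 !mul0r.
have [P0 PE] := root4P #|B|%:R (ler0n _ _).
set P := root4 _ in P0 PE.
have hS2 : K1 ^+ #|D| * P ^+ 5 * #|A|%:R ^+ 4 <= S2.
  have := reverse_hypercontractivity (g := Au) (c := fun=> 1)
    (isT : (0 < 4)%N) (ltW t2) K10 root4P tp1 _ Au0 w0 injD P0.
  rewrite sum_subcube_fibers.
  have -> : \sum_v g v = #|A|%:R.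
    by rewrite /g -sumr_const [RHS]big_mkcond; apply: eq_bigr => v _; case: (v \in A).
  move=> /(_ _ _)/le_trans; apply.
  - by move=> _; rewrite ler01.
  - by rewrite PE expr1n sumr_const.
  rewrite exchange_big /=; apply: ler_sum => u _.
  rewrite /W exprMn sqr_sqrtr // /Fu mulr_suml; apply: ler_sum => b _.
  by rewrite expr1n mul1r mulrC (exprM (Au u) 2 2).
have hpm : S2 ^+ 3 <= 2 ^+ #|D| * S3 ^+ 2.
  by have := power_mean23 (subcube D w0) W0; rewrite card_subcube natrX.
set Y := K1 ^+ #|D| * P ^+ 5 * #|A|%:R ^+ 4 in hS2.
have Y0 : 0 <= Y by rewrite !mulr_ge0 ?exprn_ge0 ?ler0n.
(* The factor [2 ^ (4 * #|D|)] is the price of the power mean inequality; it turns the [2 ^ 51] in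
   [K1 ^ 12] into [2 ^ 55]. *)
have hY : Y ^+ 12 <= 2 ^+ (4 * #|D|) * S3 ^+ 8.
  have -> : 2 ^+ (4 * #|D|) * S3 ^+ 8 = (2 ^+ #|D| * S3 ^+ 2) ^+ 4.
    by rewrite exprMn -!exprM mulnC.
  rewrite (exprM _ 3 4) lerXn2r ?nnegrE ?exprn_ge0 //.
    by rewrite mulr_ge0 ?exprn_ge0.
  by apply: le_trans hpm; rewrite lerXn2r ?nnegrE // (le_trans Y0).
have hZ8 : (K2 ^+ #|~: D| * S3) ^+ 8 <= Z ^+ 8.
  have KS : 0 <= K2 ^+ #|~: D| * S3 by rewrite mulr_ge0 ?exprn_ge0.
  by rewrite lerXn2r ?nnegrE // (le_trans KS).
apply: le_trans hZ8; rewrite [leRHS]exprMn.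
have -> : (1 + s ^+ 3) ^+ 8 / 2 ^+ 52 = K2 ^+ 8.
  by rewrite (exprM K2 2 4) K2E expr_div_n -!exprM.
have -> : (1 + s ^+ 2) ^+ 12 / 2 ^+ 55 = K1 ^+ 12 / 2 ^+ 4.
  rewrite (exprM K1 4 3) K1E expr_div_n -!exprM (exprD 2 51 4); field.
  by rewrite ?expf_neq0 ?pnatr_eq0.
rewrite -mulrA -mulrA exprAC ler_wpM2l ?exprn_ge0 //.
rewrite -(ler_pM2l (p2 (4 * #|D|)%N)); apply: le_trans hY.
have e1 : (K1 ^+ #|D|) ^+ 12 = (K1 ^+ 12 / 2 ^+ 4) ^+ #|D| * 2 ^+ (4 * #|D|).
  by rewrite expr_div_n -[(2 ^+ 4) ^+ _]exprM divfK ?gt_eqF // exprAC.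
have e2 : (P ^+ 5) ^+ 12 = #|B|%:R ^+ 15 by rewrite -PE -!exprM.
have -> : Y ^+ 12 = (K1 ^+ #|D|) ^+ 12 * (P ^+ 5) ^+ 12 * #|A|%:R ^+ 48.
  by rewrite /Y [LHS]exprMn [X in X * _]exprMn -[(_ ^+ 4) ^+ 12]exprM.
rewrite e1 e2 le_eqVlt; apply/orP; left; apply/eqP.
by move: ((_ / _) ^+ _) (2 ^+ (4 * _)) => z1 z2; ring.
Qed.

(** In the product of [two_stage] for [D] and for its complement, [#|D|] and [#|~: D|] add up to
    [n], so the unknown size of [D] disappears. Then [|F| >= |A| |B| / 2 ^ n] replaces [|F| ^ 30],
    which gives [126 = 96 + 30] and [137 = 52 + 55 + 30]. *)
Lemma udcp_density_bound (R : rcfType) (n : nat) (A B : {set word n}) (s : R) :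
  UDCP A B -> 0 < s ->
  18 * (1 - s ^+ 3) ^+ 2 <= 5 * (1 + s ^+ 3) ^+ 2 ->
  20 * (1 - s ^+ 2) ^+ 2 <= 3 * (1 + s ^+ 2) ^+ 2 ->
  ((1 + s ^+ 3) ^+ 8 * (1 + s ^+ 2) ^+ 12) ^+ n * #|A|%:R ^+ 126 * #|B|%:R ^+ 30 <=
  ((1 + 2 * s ^+ 3) ^+ 16 * 2 ^+ 137) ^+ n.
Proof.
move=> AB s0 hs3 hs2; have [D hD] := exists_flippable A B.
set F := flippable A B D in hD.
have iD : inj_on_coords D F by apply: flippable_inj.
have iC : inj_on_coords (~: D) F by apply: flippable_injC.
have t3 : 0 < s ^+ 3 by rewrite exprn_gt0.
have t2 : 0 < s ^+ 2 by rewrite exprn_gt0.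
have p2 k : 0 < 2 ^+ k :> R by rewrite exprn_gt0.
set Z := \sum_(a in A) \sum_(b in F) (s ^+ 3) ^+ hdist setT b a.
have Z0 : 0 <= Z.
  by apply: sumr_ge0 => a _; apply: sumr_ge0 => b _; rewrite exprn_ge0 // ltW.
have hZ : Z <= (1 + 2 * s ^+ 3) ^+ n.
  apply: van_Tilborg; last exact: ltW.
  by move=> a1 a2 b1 b2 h1 h2; rewrite !inE => /andP[h3 _] /andP[h4 _]; apply: AB.
have h1 := two_stage A iD iC s0 hs3 hs2.
have h2 : _ <= Z ^+ 8 := two_stage (D := ~: D) A iC _ s0 hs3 hs2.
rewrite setCK in h2; have {}h2 := h2 iD.
set c2 := (1 + s ^+ 3) ^+ 8 / 2 ^+ 52 in h1 h2.
set c1 := (1 + s ^+ 2) ^+ 12 / 2 ^+ 55 in h1 h2.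
have c20 : 0 <= c2 by rewrite divr_ge0 ?exprn_ge0 ?addr_ge0 // ltW.
have c10 : 0 <= c1 by rewrite divr_ge0 ?exprn_ge0 ?addr_ge0 // ltW.
have hn : (#|D| + #|~: D|)%N = n by rewrite cardsC card_ord.
set a : R := #|A|%:R in h1 h2 *; set f : R := #|F|%:R in h1 h2.
have a0 : 0 <= a by rewrite ler0n.
have f0 : 0 <= f by rewrite ler0n.
have h3 : (c1 * c2) ^+ n * f ^+ 30 * a ^+ 96 <= ((1 + 2 * s ^+ 3) ^+ n) ^+ 16.
  apply: (@le_trans _ _ (Z ^+ 8 * Z ^+ 8)).
    rewrite -hn; apply: le_trans (ler_pM _ _ h1 h2);
      rewrite ?mulr_ge0 ?exprn_ge0 // le_eqVlt; apply/orP; left; apply/eqP.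
    by rewrite exprMn !exprD; ring.
  by rewrite -exprD lerXn2r ?nnegrE // (le_trans Z0).
have h4 : a * #|B|%:R <= f * 2 ^+ n by rewrite /a /f -natrX -!natrM ler_nat.
have ab0 : 0 <= a * #|B|%:R by rewrite mulr_ge0 ?ler0n.
have h5 : (a * #|B|%:R) ^+ 30 <= (f * 2 ^+ n) ^+ 30.
  by rewrite lerXn2r ?nnegrE // (le_trans ab0).
have cc : (1 + s ^+ 3) ^+ 8 * (1 + s ^+ 2) ^+ 12 = c1 * c2 * 2 ^+ 107.
  by rewrite (exprD 2 52 55) /c1 /c2; field; rewrite ?expf_neq0 ?pnatr_eq0.
rewrite cc.
have -> : (c1 * c2 * 2 ^+ 107) ^+ n * a ^+ 126 * #|B|%:R ^+ 30 =
   (2 ^+ 107) ^+ n * ((c1 * c2) ^+ n * a ^+ 96) * (a * #|B|%:R) ^+ 30.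
  by rewrite [(_ * 2 ^+ 107) ^+ n]exprMn; ring.
have L0 : 0 <= (2 ^+ 107) ^+ n * ((c1 * c2) ^+ n * a ^+ 96).
  by rewrite !mulr_ge0 ?exprn_ge0 // mulr_ge0.
apply: le_trans (ler_wpM2l L0 h5) _.
have -> : (2 ^+ 107) ^+ n * ((c1 * c2) ^+ n * a ^+ 96) * (f * 2 ^+ n) ^+ 30 =
   (2 ^+ 137) ^+ n * ((c1 * c2) ^+ n * f ^+ 30 * a ^+ 96).
  rewrite (exprD 2 107 30) [(2 ^+ 107 * _) ^+ n]exprMn [(f * _) ^+ 30]exprMn [(2 ^+ 30) ^+ n]exprAC.
  by ring.
by rewrite [leRHS]exprMn [leRHS]mulrC [(_ ^+ 16) ^+ n]exprAC ler_wpM2l // exprn_ge0 // ltW ?p2.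
Qed.

Lemma udcp_card_le (n : nat) (A B : {set word n}) : UDCP A B -> (#|A| * #|B| <= 3 ^ n)%N.
Proof.
move=> AB; have := van_Tilborg AB (@ler01 rat).
under eq_bigr do under eq_bigr do rewrite expr1n.
under eq_bigr do rewrite sumr_const.
rewrite sumr_const -mulrnA mulr1.
by rewrite (_ : 1 + 2 = 3%:R :> rat) // -natrX ler_nat mulnC.
Qed.

(** The condition on [s ^ 3] requires [s] to be at least about 0.677, and [17 / 25] is slightly
    above. Stating the constants by equations eases the passage to the reals of Stdlib. *)
Lemma udcp_density_bound_17_25 (R : rcfType) (n : nat) (A B : {set word n}) (s x y z : R) :
  UDCP A B -> 25 * s = 17 -> x = 1 + s ^+ 3 -> y = 1 + s ^+ 2 -> z = 1 + 2 * s ^+ 3 ->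
  (x ^+ 8 * y ^+ 12) ^+ n * #|A|%:R ^+ 126 * #|B|%:R ^+ 30 <= (z ^+ 16 * 2 ^+ 137) ^+ n.
Proof.
move=> AB hs -> -> ->; have {hs}-> : s = 17 / 25 by lra.
apply: udcp_density_bound => //; lra.
Qed.

(* Logarithms, numerical constants and the final bound *)
Local Close Scope ring_scope.
From Stdlib Require Import Reals Lra.
Local Open Scope R_scope.

Lemma ln_le (x y : R) : 0 < x -> x <= y -> ln x <= ln y.
Proof. by move=> x0 [h|->]; [apply/Rlt_le/ln_increasing | apply: Rle_refl]. Qed.

Lemma ln_pow_le (x y : R) (k l : nat) : 0 < x -> 0 < y -> x ^ k < y ^ l ->
  INR k * ln x <= INR l * ln y.
Proof.
by move=> x0 y0 h; rewrite -!ln_pow //; apply/Rlt_le/ln_increasing => //; apply: pow_lt.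
Qed.

(** This is [3 ^ 200 < 2 ^ 317], checked on integers; the binary logarithm of 3 is thus at most
    1.585. *)
Lemma ln3_le : 200 * ln 3 <= 317 * ln 2.
Proof.
have := @ln_pow_le 3 2 200 317.
rewrite (INR_IZR_INZ 200) (INR_IZR_INZ 317).
change (Z.of_nat 200) with 200%Z; change (Z.of_nat 317) with 317%Z.
apply; [Lra.lra|Lra.lra|].
rewrite !pow_IZR; apply: IZR_lt; vm_compute; reflexivity.
Qed.

(** For [s = 17 / 25] the three fractions are [1 + 2 s ^ 3], [1 + s ^ 3] and
    [1 + s ^ 2]. *)
Lemma density_const_le : 5 * (16 * ln (25451 / 15625) + 137 * ln 2) <=
  693 * ln 2 + 5 * (8 * ln (20538 / 15625) + 12 * ln (914 / 625)).
Proof.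
have lnq p q : 0 < p -> 0 < q -> ln (p / q) = ln p - ln q.
  by move=> p0 q0; rewrite /Rdiv ln_mult ?ln_Rinv //; apply: Rinv_0_lt_compat.
rewrite !lnq; try Lra.lra.
have e15625 : ln 15625 = 6 * ln 5.
  have -> : 15625 = 5 ^ 6 by Lra.lra.
  by rewrite ln_pow; [rewrite INR_IZR_INZ|Lra.lra].
have e625 : ln 625 = 4 * ln 5.
  have -> : 625 = 5 ^ 4 by Lra.lra.
  by rewrite ln_pow; [rewrite INR_IZR_INZ|Lra.lra].
have p2 : 0 < 2 ^ 8 by apply: pow_lt; Lra.lra.
have p3 : 0 < 20538 ^ 40 by apply: pow_lt; Lra.lra.
have p4 : 0 < 914 ^ 60 by apply: pow_lt; Lra.lra.
(* The terms in [ln 5] cancel, 480 on each side, and [693 - 5 * 137 = 8] leaves the factor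
   [2 ^ 8]. *)
have : ln (25451 ^ 80) <= ln (2 ^ 8 * 20538 ^ 40 * 914 ^ 60).
  apply/Rlt_le/ln_increasing; first by apply: pow_lt; Lra.lra.
  by rewrite !pow_IZR -!mult_IZR; apply: IZR_lt; vm_compute.
rewrite (ln_mult _ _ (Rmult_lt_0_compat _ _ p2 p3) p4) (ln_mult _ _ p2 p3).
clear p2 p3 p4; rewrite !ln_pow; try Lra.lra.
rewrite !INR_IZR_INZ e15625 e625.
change (Z.of_nat 80) with 80%Z; change (Z.of_nat 8) with 8%Z.
change (Z.of_nat 40) with 40%Z; change (Z.of_nat 60) with 60%Z.
Lra.lra.
Qed.

Lemma udcp_density_ln (n : nat) (A B : {set word n}) :
  UDCP A B -> 0 < INR #|A| -> 0 < INR #|B| ->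
  126 * ln (INR #|A|) + 30 * ln (INR #|B|) <= INR n * (1386 / 10 * ln 2).
Proof.
move=> AB A0 B0.
pose s : R := 17 / 25; pose x : R := 20538 / 15625.
pose y : R := 914 / 625; pose z : R := 25451 / 15625.
have h : (x ^ 8 * y ^ 12) ^ n * INR #|A| ^ 126 * INR #|B| ^ 30 <=
         (z ^ 16 * INR 2 ^ 137) ^ n.
  have := @udcp_density_bound_17_25 R n A B s x y z AB.
  rewrite -!RpowE -!INRE -!R1E -!RmultE -!RplusE => hh.
  by apply/RleP/hh; rewrite ?INR_IZR_INZ /x /y /z /s /=; Lra.lra.
have [x0 y0 z0] : [/\ 0 < x, 0 < y & 0 < z] by rewrite /x /y /z; split; Lra.lra.
have P k (u : R) : 0 < u -> 0 < u ^ k by move=> u0; apply: pow_lt.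
have two0 : 0 < INR 2 by apply: lt_0_INR; apply/ssrnat.ltP.
have xy0 := Rmult_lt_0_compat _ _ (P 8%nat x x0) (P 12%nat y y0).
have zz0 := Rmult_lt_0_compat _ _ (P 16%nat z z0) (P 137%nat _ two0).
have L0 := Rmult_lt_0_compat _ _ (P n _ xy0) (P 126%nat _ A0).
have {}h : ln ((x ^ 8 * y ^ 12) ^ n * INR #|A| ^ 126 * INR #|B| ^ 30) <=
    ln ((z ^ 16 * INR 2 ^ 137) ^ n).
  apply: ln_le => //; exact: (Rmult_lt_0_compat _ _ L0 (P 30%nat _ B0)).
move: h; rewrite (ln_mult _ _ L0 (P 30%nat _ B0)) (ln_mult _ _ (P n _ xy0) (P 126%nat _ A0)).
rewrite (ln_pow _ xy0) (ln_pow _ zz0) (ln_mult _ _ (P 8%nat x x0) (P 12%nat y y0)).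
rewrite (ln_mult _ _ (P 16%nat z z0) (P 137%nat _ two0)).
rewrite (ln_pow _ x0) (ln_pow _ y0) (ln_pow _ z0) (ln_pow _ two0) (ln_pow _ A0) (ln_pow _ B0).
have hc := density_const_le; rewrite -/x -/y -/z in hc.
rewrite !(INR_IZR_INZ 2, INR_IZR_INZ 8, INR_IZR_INZ 12, INR_IZR_INZ 16, INR_IZR_INZ 30,
  INR_IZR_INZ 126, INR_IZR_INZ 137).
rewrite [Z.of_nat 2]/= [Z.of_nat 8]/= [Z.of_nat 12]/= [Z.of_nat 16]/= [Z.of_nat 30]/=
  [Z.of_nat 126]/= [Z.of_nat 137]/= => h.
have := Rmult_le_compat_l _ _ _ (pos_INR n) hc; move: h.
set a := ln (INR _); set b := ln (INR _).
Lra.nra.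
Qed.

Lemma udcp_card_ln (n : nat) (A B : {set word n}) :
  UDCP A B -> 0 < INR #|A| -> 0 < INR #|B| ->
  ln (INR #|A|) + ln (INR #|B|) <= INR n * (317 / 200 * ln 2).
Proof.
move=> AB A0 B0; rewrite -ln_mult // -mult_INR.
apply: (@Rle_trans _ (ln (INR (expn 3 n)))).
  apply: ln_le; first by rewrite mult_INR; apply: Rmult_lt_0_compat.
  by apply/le_INR/ssrnat.leP; exact: udcp_card_le.
have -> : INR (expn 3 n) = 3 ^ n.
  by elim: n {A B AB A0 B0} => [|n IH] //; rewrite expnS mult_INR IH !INR_IZR_INZ.
rewrite ln_pow; last by Lra.lra.
apply: Rmult_le_compat_l; first exact: pos_INR.
have := ln3_le; Lra.lra.
Qed.

Lemma udcp_rate_le (n : nat) (eps beta : R) (A B : {set word n}) :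
  (0 < n)%nat -> 0 <= eps -> UDCP A B ->
  Rpower 2 ((1 - eps) * INR n) <= INR #|A| -> INR #|B| = Rpower 2 (beta * INR n) ->
  beta <= 4228 / 10000 + sqrt eps.
Proof.
move=> n1 eps0 AB hA hB.
have n0 : 0 < INR n by apply: lt_0_INR; apply/ssrnat.ltP.
have A0 : 0 < INR #|A| by apply: Rlt_le_trans hA; apply: exp_pos.
have B0 : 0 < INR #|B| by rewrite hB; apply: exp_pos.
have l2 : 0 < ln 2 by rewrite -ln_1; apply: ln_increasing; Lra.lra.
have lB : ln (INR #|B|) = beta * INR n * ln 2 by rewrite hB ln_Rpower.
have lA : (1 - eps) * INR n * ln 2 <= ln (INR #|A|).
  by rewrite -ln_Rpower; apply: ln_le => //; apply: exp_pos.
have N0 : 0 < INR n * ln 2 by apply: Rmult_lt_0_compat.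
have h1 : 126 * (1 - eps) + 30 * beta <= 1386 / 10.
  apply: (Rmult_le_reg_r (INR n * ln 2)) => //.
  have := udcp_density_ln AB A0 B0; rewrite lB; Lra.lra.
have h2 : (1 - eps) + beta <= 317 / 200.
  apply: (Rmult_le_reg_r (INR n * ln 2)) => //.
  have := udcp_card_ln AB A0 B0; rewrite lB; Lra.lra.
have h3 : beta <= 1.
  apply: (Rmult_le_reg_r (INR n * ln 2)) => //.
  have : ln (INR #|B|) <= ln (2 ^ n).
    apply: ln_le => //.
    have <- : INR (expn 2 n) = 2 ^ n.
      by elim: n {A B AB hA hB n1 n0 A0 B0 lB lA N0 h1 h2} => [|n IH] //;
         rewrite expnS mult_INR IH !INR_IZR_INZ.
    apply/le_INR/ssrnat.leP; apply: leq_trans (max_card _) _.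
    by rewrite card_ffun card_bool card_ord.
  by rewrite lB ln_pow; Lra.lra.
have q0 := sqrt_pos eps; have qq := sqrt_sqrt _ eps0.
set q := sqrt eps in q0 qq *; rewrite -qq in h1 h2.
(* With [eps = q ^ 2], [h1] reads [beta <= 0.42 + 4.2 q ^ 2], good up to [q = 0.23]. Then [h2], that
   is [beta <= 0.585 + q ^ 2], serves up to [q = 0.6], beyond which [beta <= 1] suffices. *)
case: (Rle_lt_dec q (23 / 100)) => hq; first by Lra.nra.
case: (Rle_lt_dec q (6 / 10)) => hq'; first by Lra.nra.
Lra.lra.
Qed.

Local Close Scope R_scope.

Theorem theorem1 (n : nat) (eps beta : R) (A B : {set word n}) :
  (1 <= n)%N -> (0 <= eps)%R -> (0 <= beta)%R ->
  UDCP A B ->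
  (Rpower 2 ((1 - eps) * INR n) <= INR #|A|)%R ->
  INR #|B| = Rpower 2 (beta * INR n) ->
  (beta <= 4228 / 10000 + sqrt eps)%R.
Proof.
by move=> n1 eps0 _; apply: udcp_rate_le.
Qed.
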